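(* Let $(X_1,Y_1),\ldots,(X_{m+1},Y_{m+1})$ be data points, $R(\cdot,\cdot)$ a pre-trained non-conformity score function with non-negative real values, and $R_i=R(X_i,Y_i)$ for $1\le i\le m+1$. Let $R_{(1)}\le\cdots\le R_{(m)}$ be the order statistics of $R_1,\ldots,R_m$, and let $\widehat C_{m,\alpha}(X_{m+1})=\{y:R(X_{m+1},y)\le R_{(\lceil(m+1)(1-\alpha)\rceil)}\}$. Set $\delta=\Gamma(R_1,\ldots,R_m,R_{m+1})$. Then for any $(m+1)$-dimensional vector of scores $(R_1,\ldots,R_m,R_{m+1})$ (with arbitrary joint distribution) and any $0<\alpha<1$, $$\mathbb P\big(Y_{m+1}\in\widehat C_{m,\alpha}(X_{m+1})\big)-(1-\alpha)\ge-\delta.$$ Additionally, if the distributions of the random variables $R_1,\ldots,R_{m+1}$ are continuous, then $$\mathbb P\big(Y_{m+1}\in\widehat C_{m,\alpha}(X_{m+1})\big)-(1-\alpha)\le\delta+\frac2{m+1}.$$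
   Context: Let $S=(R_1,\ldots,R_{m+1})$; for $1\le i\le m$ let $S^i=(R_1,\ldots,R_{i-1},R_{m+1},R_{i+1},\ldots,R_m,R_i)$ be $S$ with $R_{m+1}$ and $R_i$ swapped, and $S^{m+1}=S$. Then $$\Gamma(R_1,\ldots,R_m,R_{m+1})=\sup_A\Big|\mathbb P(S\in A)-\frac1{m+1}\sum_{i=1}^{m+1}\mathbb P(S^i\in A)\Big|,$$ the supremum being over all measurable sets $A$. When the index $\lceil(m+1)(1-\alpha)\rceil$ equals $m+1$, the order statistic $R_{(m+1)}$ is set to be $\max\{w:w\in\mathcal W\}$, where $\mathcal W\subset\mathbb R$ is the space in which the scores take their values.
   Formalization: For the upper bound, besides continuous distributions of each R_i, it is assumed that P(R_i = R_j) = 0 for i ≠ j; with continuous marginals alone the bound fails (all R_i equal to one uniform variable, m = 9, α = 0.9). *)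

(* Defs.v *)
From HB Require Import structures.
From mathcomp Require Import all_boot all_order all_algebra all_fingroup.
From mathcomp Require Import all_classical all_reals all_analysis.

Set Implicit Arguments.
Unset Strict Implicit.
Unset Printing Implicit Defensive.

Import Order.TTheory GRing.Theory Num.Theory.
Import numFieldNormedType.Exports.

Local Open Scope classical_set_scope.
Local Open Scope ring_scope.

Section Scores.
Context d dX dY (Omega : measurableType d) (TX : measurableType dX)
  (TY : measurableType dY) (R : realType) (P : probability Omega R).

Definition scoreRV (score : {mfun (TX * TY)%type >-> R})
    (X : {RV P >-> TX}) (Y : {RV P >-> TY}) : Omega -> R :=
  fun w => score (X w, Y w).

Lemma measurable_scoreRV (score : {mfun (TX * TY)%type >-> R})
    (X : {RV P >-> TX}) (Y : {RV P >-> TY}) :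
  measurable_fun setT (scoreRV score X Y).
Proof.
apply: (measurableT_comp (f := score)) => //.
exact: measurable_fun_pair.
Qed.

HB.instance Definition _ (score : {mfun (TX * TY)%type >-> R})
    (X : {RV P >-> TX}) (Y : {RV P >-> TY}) :=
  isMeasurableFun.Build _ _ _ _ (scoreRV score X Y)
    (measurable_scoreRV score X Y).

End Scores.

Section Gamma.
Context d (Omega : measurableType d) (R : realType) (P : probability Omega R).
Context (m : nat) (S : 'I_m.+1 -> {RV P >-> R}).

(* S with the coordinates i and m+1 exchanged; since [tperm ord_max ord_max]
   is the identity, [swapped ord_max] is S itself. *)
Definition swapped (i : 'I_m.+1) (w : Omega) : m.+1.-tuple R :=
  [tuple S (tperm i ord_max j) w | j < m.+1].

Definition Gamma : R :=
  sup [set `| fine (P [set w | A [tuple S j w | j < m.+1]])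
              - m.+1%:R^-1 *
                \sum_(i < m.+1) fine (P [set w | A (swapped i w)]) |
      | A in [set A : set (m.+1.-tuple R) | measurable A]].

End Gamma.

Section PredictionSet.
Context (R : realType).

(* The order statistics are numbered from 1. *)
Definition order_stat (m : nat) (r : 'I_m -> R) (k : nat) : R :=
  nth 0 (sort <=%R [seq r i | i <- enum 'I_m]) k.-1.

Definition conformal_index (m : nat) (alpha : R) : nat :=
  `|Num.ceil (m.+1%:R * (1 - alpha))|%N.

(* The convention R_(m+1) = max W is read in the extended reals, as the
   supremum of W: it is max W when W has a maximum, and +oo when W is
   unbounded above. *)
Definition conformal_threshold (W : set R) (m : nat) (r : 'I_m -> R)
    (alpha : R) : \bar R :=
  let k := conformal_index m alpha in
  if k == m.+1 then ereal_sup [set w%:E | w in W] else (order_stat r k)%:E.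

Definition conformal_set (TX TY : Type) (score : TX * TY -> R) (W : set R)
    (m : nat) (r : 'I_m -> R) (alpha : R) (x : TX) : set TY :=
  [set y | ((score (x, y))%:E <= conformal_threshold W r alpha)%E].

End PredictionSet.

Section Coverage.
Context d dX dY (Omega : measurableType d) (TX : measurableType dX)
  (TY : measurableType dY) (R : realType) (P : probability Omega R).

Definition coverage (score : {mfun (TX * TY)%type >-> R}) (W : set R) (m : nat)
    (X : 'I_m.+1 -> {RV P >-> TX}) (Y : 'I_m.+1 -> {RV P >-> TY})
    (alpha : R) : R :=
  fine (P [set w | conformal_set score W
    (fun i : 'I_m => scoreRV score (X (widen_ord (leqnSn m) i))
                       (Y (widen_ord (leqnSn m) i)) w)
    alpha (X ord_max w) (Y ord_max w)]).

End Coverage.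

(* Main.v *)
(* Write k for the conformal index. If k = m+1 the prediction set is everything.
   Otherwise R_{m+1} <= R_(k) says that fewer than k coordinates of S lie
   strictly below the last one: this is an event {S \in A}. By symmetry of the
   count, {S^i \in A} is the event that fewer than k scores lie strictly below
   R_i. At every point at least k indices i have this property, and exactly k
   when there are no ties, so the mean of the P(S^i \in A) is at least k/(m+1),
   with equality when ties are null events; and
   1 - alpha <= k/(m+1) < 1 - alpha + 1/(m+1). *)
Require Import Defs.
From mathcomp Require Import all_boot all_order all_algebra all_fingroup.
From mathcomp Require Import all_classical all_reals all_analysis.
From mathcomp Require Import measurable_realfun zify lra.

Import Order.TTheory GRing.Theory Num.Theory.
Import numFieldNormedType.Exports.

Set Implicit Arguments.
Unset Strict Implicit.
Unset Printing Implicit Defensive.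

Local Open Scope classical_set_scope.
Local Open Scope ring_scope.

(** * Combinatorics of strict ranks *)

Definition nb_below (disp : Order.disp_t) (T : orderType disp) (n : nat)
    (r : 'I_n -> T) (x : T) : nat :=
  #|[pred j | (r j < x)%O]|.

Lemma nb_below_perm (disp : Order.disp_t) (T : orderType disp) (n : nat)
    (s : {perm 'I_n}) (r : 'I_n -> T) (x : T) :
  nb_below (r \o s) x = nb_below r x.
Proof.
rewrite /nb_below -(fintype.card_image (@perm_inj _ s)) /=.
apply: eq_card => j; rewrite !inE; apply/fintype.imageP/idP => [[i + ->] //|rj].
by exists (s^-1 j)%g; rewrite ?inE /= permKV.
Qed.

(** Otherwise some index fails the test. At a failing index of least value, all strictly smaller
    entries pass, so there are fewer than [k] of them and the index passes after all. Ties do no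
    harm. *)
Lemma leq_card_nb_below (disp : Order.disp_t) (T : orderType disp) (n : nat)
    (r : 'I_n -> T) (k : nat) :
  (k <= n)%N -> (k <= #|[pred i | nb_below r (r i) < k]|)%N.
Proof.
move=> kn; rewrite leqNgt; apply/negP => ltk.
have [i0 i0P] : exists i, ~~ (nb_below r (r i) < k)%N.
  apply/existsP; rewrite -negb_forall; apply: contraTN ltk => /forallP all_lt.
  rewrite -leqNgt (leq_trans kn)// -[leqLHS]card_ord subset_leq_card//.
  by apply/fintype.subsetP => i _; rewrite inE; exact: all_lt.
have [i /negP iP imin] :=
  arg_minP (P := fun i => ~~ (nb_below r (r i) < k)%N) r i0P.
apply: iP; apply: leq_ltn_trans ltk; apply: subset_leq_card.
apply/fintype.subsetP => j; rewrite !inE => rji.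
by apply: contraLR rji => /imin; rewrite -leNgt.
Qed.

(** At a passing index of greatest value, injectivity puts every other passing index strictly below
    it, so there are fewer than [k] others. *)
Lemma card_nb_below_leq (disp : Order.disp_t) (T : orderType disp) (n : nat)
    (r : 'I_n -> T) (k : nat) :
  injective r -> (#|[pred i | nb_below r (r i) < k]| <= k)%N.
Proof.
move=> r_inj.
set B := [pred i | nb_below r (r i) < k]%N.
have [/eqP ->//|/pred0Pn[i0 i0P]] := boolP (#|B| == 0)%N.
have [i iP imax] := arg_maxP (P := B) r i0P.
rewrite (cardD1 i) [i \in _]iP; apply: leq_ltn_trans (iP : (_ < k)%N).
apply: subset_leq_card; apply/fintype.subsetP => j.
rewrite !inE => /andP[ji jP].
by rewrite lt_neqAle (inj_eq r_inj) ji; exact: imax jP.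
Qed.

(** * Order statistics through counts, and the conformal index *)

(** In a sorted list the entries below [x] form a prefix; the inequality says that this prefix stops
    before position [k.-1], counted from 0. *)
Lemma count_lt_sorted (disp : Order.disp_t) (T : orderType disp) (s : seq T)
    (k : nat) (x0 x : T) :
  sorted <=%O s -> (0 < k <= size s)%N ->
  (x <= nth x0 s k.-1)%O = (count [pred y : T | (y < x)%O] s < k)%N.
Proof.
move=> s_sorted /andP[k_gt0 ks]; rewrite -{2}(cat_take_drop k.-1 s) count_cat.
have le_nth i j : (i <= j < size s)%N -> (nth x0 s i <= nth x0 s j)%O.
  move=> /andP[ij js]; apply: (sorted_leq_nth le_trans lexx) => //.
  by rewrite inE (leq_ltn_trans ij).
have [xk|kx] := leP.
  apply/esym; rewrite (_ : count _ (drop _ _) = 0%N).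
    by rewrite addn0 (leq_ltn_trans (count_size _ _))// size_takel; lia.
  apply/eqP; rewrite -leqn0 leqNgt -has_count -all_predC.
  apply/(all_nthP x0) => i; rewrite size_drop nth_drop /= -leNgt => ltis.
  by apply: le_trans xk (le_nth _ _ _); lia.
apply/esym/negbTE; rewrite -leqNgt -count_cat cat_take_drop.
(* Here the entry at [k.-1] is below [x], hence so are all of the first [k] entries. *)
rewrite -(cat_take_drop k s) count_cat.
apply: leq_trans (leq_addr _ _).
rewrite (_ : count _ _ = size (take k s)); first by rewrite size_takel.
apply/eqP; rewrite -all_count; apply/(all_nthP x0) => i.
rewrite size_takel// => ik; rewrite nth_take//=.
by apply: le_lt_trans kx; apply: le_nth; lia.
Qed.

Lemma le_order_stat (R : realType) (m : nat) (r : 'I_m -> R) (k : nat) (x : R) :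
  (0 < k <= m)%N -> (x <= order_stat r k) = (nb_below r x < k)%N.
Proof.
move=> km; rewrite /order_stat count_lt_sorted.
- have /seq.permP -> := permEl (perm_sort <=%R [seq r i | i <- enum 'I_m]).
  by rewrite count_map /nb_below cardE -size_filter enumT /enum_mem.
- exact: sort_le_sorted.
- by rewrite size_sort size_map size_enum_ord.
Qed.

(** The last score is not strictly below itself. This turns a comparison with the first [m] scores
    into a count symmetric in all [m.+1]. *)
Lemma nb_below_widen (R : realType) (m : nat) (r : 'I_m.+1 -> R) :
  nb_below (fun i : 'I_m => r (widen_ord (leqnSn m) i)) (r ord_max)
  = nb_below r (r ord_max).
Proof.
rewrite /nb_below -!sum1_card [RHS]big_mkcond big_ord_recr /=.
by rewrite inE ltxx addn0 -big_mkcond.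
Qed.

Lemma conformal_indexP (R : realType) (m : nat) (alpha : R) :
  0 < alpha < 1 ->
  [/\ (0 < conformal_index m alpha <= m.+1)%N,
      m.+1%:R * (1 - alpha) <= (conformal_index m alpha)%:R &
      (conformal_index m alpha)%:R < m.+1%:R * (1 - alpha) + 1].
Proof.
move=> /andP[a0 a1]; set x := m.+1%:R * (1 - alpha).
have m_gt0 : 0 < m.+1%:R :> R by [].
have x_gt0 : 0 < x by rewrite mulr_gt0// subr_gt0.
(* The ceiling is positive, so the absolute value in [conformal_index] changes nothing. *)
have kE : (conformal_index m alpha)%:R = (Num.ceil x)%:~R :> R.
  by rewrite /conformal_index natr_absz gtr0_norm// ceil_gt0.
split; first last.
- by rewrite kE; have /andP[] := ceil_itv x; rewrite intrB; lra.
- by rewrite kE ceil_ge.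
have : Num.ceil x <= m.+1%:Z.
  by rewrite ceil_le_int /x -[leRHS]mulr1 ler_pM2l//; lra.
have : 0 < Num.ceil x by rewrite ceil_gt0.
by rewrite /conformal_index -/x; lia.
Qed.

(** * Measurability and expectation of the counts *)

Lemma card_sum_indic (T : Type) (R : realType) (n : nat) (b : 'I_n -> T -> bool)
    (w : T) :
  #|[pred i | b i w]|%:R = \sum_i \1_[set w | b i w] w :> R.
Proof.
rewrite -sum1_card natr_sum big_mkcond /=; apply: eq_bigr => i _.
rewrite indicE -topredE /=; case: ifPn => biw; first by rewrite mem_set.
by rewrite memNset//; exact/negP.
Qed.

Lemma measurable_nb_below (d : measure_display) (T : measurableType d)
    (R : realType) (n : nat) (f : 'I_n -> T -> R) (g : T -> R) (k : nat) :
  (forall i, measurable_fun setT (f i)) -> measurable_fun setT g ->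
  measurable [set w | nb_below (f^~ w) (g w) < k]%N.
Proof.
move=> mf mg.
rewrite [X in measurable X](_ : _ = [set w |
    \sum_i \1_[set w | f i w < g w] w < k%:R :> R]); last first.
  apply/seteqP; split=> w /=; rewrite /nb_below -(ltr_nat R).
    by rewrite (card_sum_indic _ (fun i w => f i w < g w)).
  by rewrite (card_sum_indic _ (fun i w => f i w < g w)).
rewrite -[X in measurable X]setTI.
apply: (measurable_fun_ltr _ _ measurableT (Y := [set true])) => //.
apply: measurable_sum => i; apply: measurable_indic.
rewrite -[X in measurable X]setTI.
exact: (measurable_fun_ltr _ _ measurableT (Y := [set true])).
Qed.

Section Ranks.
Context d (T : measurableType d) (R : realType) (P : probability T R).
Context (n : nat).

(** Linearity of expectation, the count being a sum of indicators. *)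
Lemma integral_card (b : 'I_n -> T -> bool) :
  (forall i, measurable [set w | b i w]) ->
  (\int[P]_w #|[pred i | b i w]|%:R%:E = \sum_i P [set w | b i w])%E.
Proof.
move=> mb; under eq_integral do rewrite card_sum_indic -sumEFin.
rewrite ge0_integral_sum//.
  by apply: eq_bigr => i _; rewrite integral_indic// setIT.
by move=> i; apply/measurable_EFinP; exact: measurable_indic.
Qed.

Context (f : 'I_n -> T -> R) (mf : forall i, measurable_fun setT (f i)).

Let measurable_rank k i : measurable [set w | nb_below (f^~ w) (f i w) < k]%N.
Proof. exact: measurable_nb_below. Qed.

Let measurable_card k : measurable_fun setT
  (fun w => #|[pred i | nb_below (f^~ w) (f i w) < k]%N|%:R%:E : \bar R).
Proof.
apply/measurable_EFinP.
under eq_fun do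
  rewrite (card_sum_indic _ (fun i w => nb_below (f^~ w) (f i w) < k)%N).
by apply: measurable_sum => i; exact: measurable_indic.
Qed.

Lemma sum_rank_ge (k : nat) : (k <= n)%N ->
  (k%:R%:E <= \sum_i P [set w | nb_below (f^~ w) (f i w) < k]%N)%E.
Proof.
move=> kn; rewrite -integral_card//.
(* Since [P] has mass 1, [k] is the integral of a constant, and the pointwise bound can be
   integrated. *)
rewrite -[leLHS]mule1 -(probability_setT P) -integral_cst//.
apply: ge0_le_integral => //= w _; rewrite lee_fin//.
by rewrite ler_nat leq_card_nb_below.
Qed.

Lemma sum_rank_le (k : nat) :
  (forall i j, i != j -> P [set w | f i w = f j w] = 0%E) ->
  (\sum_i P [set w | nb_below (f^~ w) (f i w) < k]%N <= k%:R%:E)%E.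
Proof.
move=> f_neq; rewrite -integral_card//.
rewrite -[leRHS]mule1 -(probability_setT P) -integral_cst//.
apply: ae_ge0_le_integral => //=; do ?by move=> w _; rewrite lee_fin.
(* Finitely many pairs, each tied only on a null set: almost surely there are no ties at all. *)
have f_inj : \forall w \ae P, forall ij : 'I_n * 'I_n,
    ij.1 != ij.2 -> f ij.1 w <> f ij.2 w.
  apply: filter_forall => -[i j] /=; have [->|ij] := eqVneq i j.
    by apply: nearW => w /eqP.
  exists [set w | f i w = f j w]; split; last 2 first.
  - exact: f_neq.
  - by move=> w /= /not_implyP[_ /contrapT].
  - rewrite (_ : [set w | f i w = f j w] =
        setT `&` (fun w => f i w == f j w) @^-1` [set true]).
      exact: measurable_fun_eqr.
    by apply/seteqP; split=> w /=; [move=> ->; rewrite eqxx | case=> _ /eqP].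
apply: filterS f_inj => w f_inj _.
rewrite lee_fin ler_nat card_nb_below_leq// => i j fij.
by apply/eqP; apply: contraT => /(f_inj (i, j)).
Qed.

End Ranks.

(** * The coefficient [Gamma] as a real supremum *)

Section GammaTheory.
Context d (T : measurableType d) (R : realType) (P : probability T R).
Context (m : nat) (S : 'I_m.+1 -> {RV P >-> R}).

Lemma le_Gamma (A : set (m.+1.-tuple R)) : measurable A ->
  `| fine (P [set w | A [tuple S j w | j < m.+1]])
     - m.+1%:R^-1 * \sum_(i < m.+1) fine (P [set w | A (swapped S i w)]) |
  <= Gamma S.
Proof.
move=> mA; apply: ub_le_sup; last by exists A.
(* A real [sup] dominates its set only if the set is bounded. The bound 1 works because a
   probability and a mean of probabilities both lie in [0, 1]. *)
exists 1 => _ [B mB <-].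
have m_tuple (s : 'I_m.+1 -> 'I_m.+1) :
    measurable [set w | B [tuple S (s j) w | j < m.+1]].
  rewrite -[X in measurable X]setTI.
  apply: (_ : measurable_fun setT (fun w => [tuple S (s j) w | j < m.+1])) => //.
  apply/measurable_fun_tnthP => j.
  rewrite (_ : _ \o _ = S (s j))//.
  by apply/funext => w /=; rewrite tnth_mktuple.
have prob01 (s : 'I_m.+1 -> 'I_m.+1) :
    0 <= fine (P [set w | B [tuple S (s j) w | j < m.+1]]) <= 1.
  rewrite fine_ge0//= -lee_fin fineK ?fin_num_measure//.
  exact: probability_le1.
have p01 : 0 <= fine (P [set w | B [tuple S j w | j < m.+1]]) <= 1.
  exact: prob01 id.
have q01 : 0 <= m.+1%:R^-1 *
    \sum_(i < m.+1) fine (P [set w | B (swapped S i w)]) <= 1.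
  apply/andP; split.
    rewrite mulr_ge0// sumr_ge0// => i _.
    by have /andP[] := prob01 (tperm i ord_max).
  rewrite mulrC ler_pdivrMr// mul1r.
  apply: le_trans (ler_sum _ (_ : forall i, true -> _ <= 1)) _ => [i _|].
    by have /andP[] := prob01 (tperm i ord_max).
  by rewrite sumr_const card_ord.
by move: p01 q01; set p := fine _; set q := _ * _; rewrite ler_norml; lra.
Qed.

Lemma Gamma_ge0 : 0 <= Gamma S.
Proof. exact: le_trans (le_Gamma measurable0). Qed.

End GammaTheory.

(** The upper bound asks for null ties besides continuous marginals: two equal scores can have a
    continuous distribution function. If all scores coincide, then [delta] is 0 and the coverage is
    1, which breaks the bound for large [m]. *)
Theorem corollary7 (d dX dY : measure_display) (Omega : measurableType d)
    (TX : measurableType dX) (TY : measurableType dY) (R : realType)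
    (P : probability Omega R) (m : nat)
    (X : 'I_m.+1 -> {RV P >-> TX}) (Y : 'I_m.+1 -> {RV P >-> TY})
    (W : set R) (score : {mfun (TX * TY)%type >-> R})
    (score_ge0 : forall z, 0 <= score z) (score_W : forall z, W (score z))
    (alpha : R) (alpha_gt0 : 0 < alpha) (alpha_lt1 : alpha < 1) :
  let S : 'I_m.+1 -> {RV P >-> R} := fun i => scoreRV score (X i) (Y i) in
  let delta := Gamma S in
  - delta <= coverage score W X Y alpha - (1 - alpha) /\
  ((forall i, continuous (cdf (S i))) ->
   (forall i j, i != j -> P [set w | S i w = S j w] = 0%E) ->
   coverage score W X Y alpha - (1 - alpha) <= delta + 2 / m.+1%:R).
Proof.
move=> S delta.
have alpha01 : 0 < alpha < 1 by rewrite alpha_gt0.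
have [/andP[k_gt0 km] k_ge k_lt] := conformal_indexP m alpha01.
set k := conformal_index m alpha in k_gt0 km k_ge k_lt.
have m_gt0 : 0 < m.+1%:R :> R by [].
have [kE|k_neq] := eqVneq k m.+1.
  have -> : coverage score W X Y alpha = 1.
    rewrite /coverage (_ : [set w | _] = setT) ?probability_setT//.
    apply/seteqP; split=> // w _.
    rewrite /conformal_set /conformal_threshold /= -/k kE eqxx.
    apply: ereal_sup_ubound; by exists (score (X ord_max w, Y ord_max w)).
  have delta_ge0 : 0 <= delta := Gamma_ge0 S.
  split=> [|_ _]; first by lra.
  (* The excess coverage is [alpha], and [k_lt] at [k = m.+1] gives [m.+1%:R * alpha < 1]. *)
  rewrite subKr ler_wpDl// ler_pdivlMr// mulrC.
  by move: k_lt; rewrite kE mulrBr mulr1; lra.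
pose A : set (m.+1.-tuple R) :=
  [set t | nb_below (tnth t) (tnth t ord_max) < k]%N.
have mA : measurable A.
  by apply: (measurable_nb_below (f := fun j t => tnth t j)) => [j|];
    exact: measurable_tnth.
have tnthE (r : 'I_m.+1 -> R) : tnth [tuple r j | j < m.+1] = r.
  by apply/funext => j; rewrite tnth_mktuple.
have coverageE : coverage score W X Y alpha =
    fine (P [set w | A [tuple S j w | j < m.+1]]).
  rewrite /coverage; congr (fine (P _)); apply/seteqP.
  have wE w : conformal_set score W
      (fun i : 'I_m => scoreRV score (X (widen_ord (leqnSn m) i))
                       (Y (widen_ord (leqnSn m) i)) w)
      alpha (X ord_max w) (Y ord_max w) = A [tuple S j w | j < m.+1].
    rewrite /A/= tnthE -(nb_below_widen (S^~ w)).
    rewrite /conformal_set /conformal_threshold /= -/k (negbTE k_neq) lee_fin.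
    (* From [k <= m.+1] and [k != m.+1] comes [k <= m], so the order statistic is a genuine entry
       and not the default 0. *)
    by rewrite le_order_stat// k_gt0 -ltnS ltn_neqAle k_neq km.
  by split=> w /=; rewrite wE.
have swapE i : [set w | A (swapped S i w)] =
    [set w | nb_below (S^~ w) (S i w) < k]%N.
  apply/seteqP; split=> w; rewrite /A /swapped/=;
    (* The transposition brings score [i] to the last place and leaves the count unchanged. *)
    by rewrite tnthE tpermR (nb_below_perm (tperm i ord_max) (S^~ w)).
have := le_Gamma S mA; rewrite -coverageE -/delta.
under eq_bigr do rewrite swapE.
have mS i : measurable_fun setT (S i) by [].
have mrank i : measurable [set w | nb_below (S^~ w) (S i w) < k]%N.
  exact: measurable_nb_below.
set mean := _ * _ => coverage_close.
have sumE : (\sum_i P [set w | nb_below (S^~ w) (S i w) < k]%N =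
    (m.+1%:R * mean)%:E)%E.
  rewrite mulVKf// -sumEFin; apply: eq_bigr => i _.
  by rewrite fineK// fin_num_measure.
move: (coverage _ _ _ _ _) coverage_close => c.
rewrite ler_norml => /andP[c_ge c_le].
have mean_ge : k%:R <= m.+1%:R * mean.
  by rewrite -lee_fin -sumE sum_rank_ge.
split=> [|_ S_neq].
  have : 1 - alpha <= mean.
    by rewrite -(ler_pM2l m_gt0) (le_trans k_ge).
  by lra.
have mean_le : m.+1%:R * mean <= k%:R.
  by rewrite -lee_fin -sumE sum_rank_le.
have : mean <= 1 - alpha + 2 / m.+1%:R.
  (* After multiplication by [m.+1] the claim follows from [mean_le] and [k_lt]. *)
  rewrite -(ler_pM2l m_gt0) mulrDr [m.+1%:R * (2 / _)]mulrC divfK//.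
  by rewrite (le_trans mean_le)//; lra.
by move: (2 / m.+1%:R) => e; lra.
Qed.
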